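(* Let $G$ be a connected $Q$-integral graph with $Q$-spectral radius $6$. Suppose that the maximum edge-degree of $G$ is $5$. If $G$ is non-bipartite, then $G$ is (isomorphic to) the graph with vertex set $\{v_1, v_2, v_3, v_4, v_5, v_6\}$ and edge set $\{v_1v_2, v_1v_3, v_2v_3, v_3v_4, v_3v_5, v_4v_5, v_4v_6, v_5v_6\}$.
   Context: All graphs are finite and simple. For a graph $G$, let $A(G)$ be its adjacency matrix and $D(G)$ the diagonal matrix of its vertex degrees; the signless Laplacian matrix of $G$ is $Q(G) = A(G) + D(G)$. The graph $G$ is $Q$-integral if all eigenvalues of $Q(G)$ are integers. The $Q$-spectral radius of $G$ is the largest eigenvalue of $Q(G)$. The edge-degree of an edge $uv$ of $G$ is the number of other edges of $G$ sharing an endpoint with it, i.e. $\deg_G(u)+\deg_G(v)-2$; the maximum edge-degree of $G$ is the maximum of this quantity over all edges of $G$. *)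

(* Defs.v *)
From mathcomp Require Import all_boot all_order all_algebra all_field.

Set Implicit Arguments.
Unset Strict Implicit.
Unset Printing Implicit Defensive.

Import Order.TTheory GRing.Theory Num.Theory.
Local Open Scope ring_scope.

Record sgraph := SGraph {
  vertex :> finType;
  adj : rel vertex;
  adj_sym : symmetric adj;
  adj_irrefl : irreflexive adj
}.

Definition deg (G : sgraph) (u : G) : nat := #|[set v | adj u v]|.

(* The matrices have entries in algC, which is algebraically closed, so that
   "all eigenvalues" ranges over the whole spectrum.  Rows and columns are
   indexed by the vertices through the enumeration of the vertex type. *)
Definition adjacency_mx (G : sgraph) : 'M[algC]_#|G| :=
  \matrix_(i, j) (adj (enum_val i : G) (enum_val j))%:R.

Definition degree_mx (G : sgraph) : 'M[algC]_#|G| :=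
  diag_mx (\row_i (deg (enum_val i : G))%:R).

Definition signless_laplacian (G : sgraph) : 'M[algC]_#|G| :=
  adjacency_mx G + degree_mx G.

Definition Q_integral (G : sgraph) : Prop :=
  forall a : algC, eigenvalue (signless_laplacian G) a -> a \is a Num.int.

(* In the partial order of algC, a <= r with r real forces a to be real. *)
Definition is_Q_spectral_radius (G : sgraph) (r : algC) : Prop :=
  eigenvalue (signless_laplacian G) r /\
  forall a : algC, eigenvalue (signless_laplacian G) a -> a <= r.

Definition connected_graph (G : sgraph) : Prop :=
  (0 < #|G|)%N /\ forall u v : G, connect (@adj G) u v.

Definition bipartite (G : sgraph) : Prop :=
  exists c : G -> bool, forall u v : G, adj u v -> c u != c v.

(* On an edge uv both degrees are positive, so the subtraction of naturals is
   exact. *)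
Definition edge_degree (G : sgraph) (u v : G) : nat := (deg u + deg v - 2)%N.

Definition max_edge_degree (G : sgraph) : nat :=
  \max_(p : G * G | adj p.1 p.2) edge_degree p.1 p.2.

Definition isomorphic (G H : sgraph) : Prop :=
  exists2 f : G -> H, bijective f & forall u v : G, adj (f u) (f v) = adj u v.

(* The vertex v_k is represented by the ordinal of value k - 1. *)
Definition target_edges : seq (nat * nat) :=
  [:: (1, 2); (1, 3); (2, 3); (3, 4); (3, 5); (4, 5); (4, 6); (5, 6)]%N.

Definition target_adj : rel 'I_6 := fun i j =>
  ((i.+1, j.+1) \in target_edges) || ((j.+1, i.+1) \in target_edges).

Lemma target_adj_sym : symmetric target_adj.
Proof. by move=> i j; rewrite /target_adj orbC. Qed.

Lemma target_adj_irrefl : irreflexive target_adj.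
Proof. by case; do 6?[case=> //]. Qed.

Definition target_graph : sgraph := SGraph target_adj_sym target_adj_irrefl.

(* Main.v *)
(* The signless Laplacian Q of G is symmetric with spectrum in {1, ..., 6}: 0 is
   excluded because x^T Q x is the sum of (x_u + x_v)^2 over the edges, which
   vanishes only for a 2-colouring of a connected graph.  By Perron-Frobenius 6
   is a simple eigenvalue with a positive eigenvector x, which can be taken to
   generate the integer eigenvectors, and then
     (Q - 1)(Q - 2)(Q - 3)(Q - 4)(Q - 5) = alpha x x^T
   with alpha a positive integer and alpha |x|^2 = 120.  Hence only finitely many
   pairs (alpha, x) are possible.

   Positivity of the spectral projectors turns every cubic that is nonnegative
   (or nonpositive) on {1, ..., 5} into a linear inequality between
   alpha x_u^2 and the first three moments (Q^k)_uu.  For given alpha this bounds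
   deg u and x_u and pins down, up to a few values, the number
   sum_{v ~ u} (deg v + |N(u) cap N(v)|).  An exhaustive search over partial
   graphs labelled by (deg u, x_u), started at a vertex of degree 4, then leaves
   the target and a few graphs that violate the displayed identity. *)
From Stdlib Require Import ZArith.
From HB Require Import structures.
Require Import Defs.
From mathcomp Require Import all_boot all_order all_algebra all_field.
From mathcomp Require Import zify ssrZ ring.

Set Implicit Arguments.
Unset Strict Implicit.
Unset Printing Implicit Defensive.

Import Order.TTheory GRing.Theory Num.Theory.
Local Open Scope ring_scope.

(** * Spectrum of the signless Laplacian *)

(** A normal matrix is unitarily similar to a diagonal one. Each diagonal entry is an eigenvalue,
    hence listed in [ks], and gives a zero factor in its place of the product. *)
Lemma normalmx_prod_sub_eq0 (C : numClosedFieldType) n (A : 'M[C]_n)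
    (ks : seq C) :
  A \is normalmx -> (forall a, eigenvalue A a -> a \in ks) ->
  \big[mulmx/1%:M]_(k <- ks) (A - k%:M) = 0.
Proof.
move=> /orthomx_spectralP; set P := spectralmx A; set D := spectral_diag A => AE.
have uP : P \in unitmx by exact: spectral_unit.
move=> eigks.
(* Row [i] of the invertible matrix [P] is an eigenvector for [D 0 i]. *)
have Dks i : D 0 i \in ks.
  apply: eigks; apply/eigenvalueP; exists (row i P).
    rewrite -row_mul {1}AE !mulmxA mulmxV //.
    by rewrite mul1mx row_mul row_diag_mx -scalemxAl -rowE.
  apply/eqP => P0; have /(congr1 (row i)) := mulmxV uP.
  rewrite row_mul P0 mul0mx => /rowP /(_ i); rewrite !mxE eqxx => /eqP.
  by rewrite eq_sym oner_eq0.
have AkE k : A - k%:M = invmx P *m diag_mx (D - const_mx k) *m P.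
  rewrite linearB /= diag_const_mx mulmxBr mulmxBl -AE.
  by rewrite scalar_mxC -mulmxA mulVmx // mulmx1.
have prodE : \big[mulmx/1%:M]_(k <- ks) (A - k%:M)
    = invmx P *m diag_mx (\row_i \prod_(k <- ks) (D 0 i - k)) *m P.
  elim: ks {eigks Dks} => [|k ks IH].
    rewrite big_nil; have -> : \row_i \prod_(k <- [::]) (D 0 i - k) = const_mx 1.
      by apply/rowP => i; rewrite !mxE big_nil.
    by rewrite diag_const_mx mulmx1 mulVmx.
  rewrite big_cons IH AkE !mulmxA mulmxK //; congr (_ *m P).
  rewrite -!mulmxA mulmx_diag; congr (_ *m diag_mx _).
  by apply/rowP => i; rewrite !mxE big_cons.
rewrite prodE; suff -> : \row_i \prod_(k <- ks) (D 0 i - k) = 0.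
  by rewrite linear0 mulmx0 mul0mx.
apply/rowP => i; rewrite !mxE; apply/eqP; rewrite prodf_seq_eq0.
by apply/hasP; exists (D 0 i); rewrite ?Dks // subrr eqxx.
Qed.

(** Q as an operator on vertex functions, over any additive monoid so that it serves for complex and
    integer vectors alike. *)
Definition qop (G : sgraph) (R : nmodType) (f : {ffun G -> R}) : {ffun G -> R} :=
  [ffun u => f u *+ deg u + \sum_(v | adj u v) f v].

Definition row_of (G : sgraph) (f : {ffun G -> algC}) : 'rV[algC]_#|G| :=
  \row_i f (enum_val i).

Lemma row_of_mul (G : sgraph) (f : {ffun G -> algC}) :
  row_of f *m signless_laplacian G = row_of (qop f).
Proof.
apply/rowP => i; rewrite mulmxDr mul_mx_diag !mxE ffunE addrC mulr_natr.
congr (_ + _); rewrite [RHS]big_mkcond [RHS](reindex (@enum_val G G)) /=;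
  last exact/onW_bij/enum_val_bij.
apply: eq_bigr => j _; rewrite !mxE adj_sym.
by case: (adj _ _); rewrite ?mulr1 ?mulr0.
Qed.

Lemma row_ofK (G : sgraph) (w : 'rV[algC]_#|G|) :
  row_of [ffun u => w 0 (enum_rank u)] = w.
Proof. by apply/rowP => i; rewrite mxE ffunE enum_valK. Qed.

Lemma row_of_inj (G : sgraph) : injective (@row_of G).
Proof.
move=> f g fg; apply/ffunP => u.
by move/rowP: fg => /(_ (enum_rank u)); rewrite !mxE enum_rankK.
Qed.

Lemma eigenvalue_qop (G : sgraph) (a : algC) :
  eigenvalue (signless_laplacian G) a ->
  exists2 f : {ffun G -> algC}, f != 0 & forall u, qop f u = a * f u.
Proof.
move=> /eigenvalueP [w wE w0]; exists [ffun u => w 0 (enum_rank u)].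
  apply: contraNneq w0 => f0; rewrite -(row_ofK w) f0.
  by apply/eqP/rowP => i; rewrite !mxE ffunE.
move=> u; move: wE; rewrite -(row_ofK w) row_of_mul row_ofK => /rowP.
by move=> /(_ (enum_rank u)); rewrite !mxE enum_rankK ffunE => ->; rewrite ffunE.
Qed.

Lemma sum_adj_exchange (G : sgraph) (R : nmodType) (F : G -> G -> R) :
  \sum_u \sum_(v | adj u v) F u v = \sum_u \sum_(v | adj u v) F v u.
Proof.
rewrite (exchange_big_dep xpredT) //=; apply: eq_bigr => u _.
by apply: eq_bigl => v; rewrite adj_sym.
Qed.

Lemma sum_adj_const (G : sgraph) (R : nmodType) (u : G) (c : R) :
  \sum_(v | adj u v) c = c *+ deg u.
Proof.
by rewrite sumr_const /deg; congr (_ *+ _); apply: eq_card => v; rewrite !inE.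
Qed.

(** Expand |a + b|^2 as conj(a)(a + b) + conj(b)(a + b); exchanging the ends of the edges shows that
    both halves have the same sum. *)
Lemma qop_form (G : sgraph) (f : {ffun G -> algC}) :
  \sum_u \sum_(v | adj u v) `|f u + f v| ^+ 2 =
  2%:R * \sum_u (f u)^* * qop f u.
Proof.
pose S1 := \sum_u \sum_(v | adj u v) (f u)^* * (f u + f v).
have S1E : S1 = \sum_u (f u)^* * qop f u.
  by apply: eq_bigr => u _; rewrite ffunE -mulr_sumr big_split /= sum_adj_const.
rewrite -S1E mulr_natl mulr2n {2}/S1 [X in _ = _ + X]sum_adj_exchange /S1.
rewrite -big_split /=.
apply: eq_bigr => u _; rewrite -big_split /=; apply: eq_bigr => v _.
by rewrite normCKC rmorphD mulrDl [f v + _]addrC.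
Qed.

(** If [a <= 0], the form of [qop_form] vanishes, so [f] changes sign along each edge; by
    connectedness [f] takes only the values [f u0] and [- f u0], which give a 2-colouring. *)
Lemma nonbipartite_eigenvalue_gt0 (G : sgraph) (a : algC) :
  connected_graph G -> ~ bipartite G -> a \is Num.real ->
  eigenvalue (signless_laplacian G) a -> 0 < a.
Proof.
move=> [_ conG] nbip ra /eigenvalue_qop [f f0 fE].
rewrite real_ltNge ?rpred0 //; apply/negP => a_le0; apply: nbip.
have term_ge0 u v : 0 <= `|f u + f v| ^+ 2 by rewrite exprn_ge0.
have S0 : \sum_u \sum_(v | adj u v) `|f u + f v| ^+ 2 == 0.
  rewrite eq_le sumr_ge0 ?andbT; last by move=> u _; apply: sumr_ge0.
  rewrite qop_form pmulr_rle0 // (eq_bigr (fun u => a * `|f u| ^+ 2)).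
    by rewrite -mulr_sumr mulr_le0_ge0 // sumr_ge0 // => u _; rewrite exprn_ge0.
  by move=> u _; rewrite fE normCKC mulrCA.
have fN u v : adj u v -> f v = - f u.
  move=> uv; move: S0; rewrite psumr_eq0; last by move=> w _; apply: sumr_ge0.
  move=> /allP /(_ u (mem_index_enum _)) /=; rewrite psumr_eq0 //.
  move=> /allP /(_ v (mem_index_enum _)); rewrite uv /= sqrf_eq0 normr_eq0.
  by rewrite addrC addr_eq0 => /eqP.
have [u0 fu0] : exists u0, f u0 != 0.
  apply/existsP; rewrite -negb_forall; apply: contra f0 => /forallP f0.
  by apply/eqP/ffunP => u; rewrite ffunE; apply/eqP.
have fpm u : (f u == f u0) || (f u == - f u0).
  have /connectP [p up ->] := conG u0 u.
  elim/last_ind: p up => [|p v IH]; first by rewrite eqxx.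
  rewrite rcons_path last_rcons => /andP [/IH fu /fN ->].
  by rewrite eqr_opp orbC eqr_oppLR.
have f2 : (- f u0 == f u0) = false.
  by apply: contraNF fu0; rewrite eq_sym -addr_eq0 -mulr2n mulrn_eq0.
exists (fun u => f u == f u0) => u v /fN ->.
by have /orP [] := fpm u => /eqP ->; rewrite ?opprK !eqxx f2.
Qed.

(** * Polynomials in Q acting on vertex functions *)

Lemma qop_is_zmod_morphism (G : sgraph) (R : zmodType) :
  zmod_morphism (@qop G R).
Proof.
move=> f g; apply/ffunP => u; rewrite !ffunE mulrnBl opprD addrACA -sumrB.
by congr (_ + _); apply: eq_bigr => v _; rewrite !ffunE.
Qed.

HB.instance Definition _ (G : sgraph) (R : zmodType) :=
  GRing.isZmodMorphism.Build {ffun G -> R} {ffun G -> R} (@qop G R)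
    (@qop_is_zmod_morphism G R).

Definition qsub (G : sgraph) (R : zmodType) (k : nat) (f : {ffun G -> R}) :
  {ffun G -> R} := qop f - f *+ k.

(** The product of the operators Q - k. For the list 1, ..., 5 it will be 120 times the projector
    onto the eigenvalue 6, as (6 - 1)...(6 - 5) = 120. *)
Definition qprod (G : sgraph) (R : zmodType) (ks : seq nat)
  (f : {ffun G -> R}) : {ffun G -> R} := foldr (fun k => @qsub G R k) f ks.

Lemma qsubE (G : sgraph) (R : zmodType) k (f : {ffun G -> R}) u :
  qsub k f u = qop f u - f u *+ k.
Proof. by rewrite /qsub; move: (qop f) => g; rewrite !ffunE ffunMnE. Qed.

Lemma qsub_is_zmod_morphism (G : sgraph) (R : zmodType) k :
  zmod_morphism (@qsub G R k).
Proof. by move=> f g; rewrite /qsub raddfB mulrnBl /= !opprD addrACA. Qed.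

HB.instance Definition _ (G : sgraph) (R : zmodType) k :=
  GRing.isZmodMorphism.Build {ffun G -> R} {ffun G -> R} (@qsub G R k)
    (@qsub_is_zmod_morphism G R k).

Lemma qsubC (G : sgraph) (R : zmodType) j k (f : {ffun G -> R}) :
  qsub j (qsub k f) = qsub k (qsub j f).
Proof.
have qopMn n : qop (f *+ n) = qop f *+ n by rewrite raddfMn.
rewrite /qsub !raddfB /= !qopMn !mulrnBl !opprB -!mulrnA mulnC.
by rewrite addrACA [RHS]addrACA; congr (_ + _); rewrite addrC.
Qed.

Lemma qprod_cons (G : sgraph) (R : zmodType) k ks (f : {ffun G -> R}) :
  qprod (k :: ks) f = qsub k (qprod ks f).
Proof. by []. Qed.

Lemma qprod_qsub (G : sgraph) (R : zmodType) ks k (f : {ffun G -> R}) :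
  qprod ks (qsub k f) = qsub k (qprod ks f).
Proof. by elim: ks => //= j ks ->; rewrite qsubC. Qed.

Lemma qprod_rem (G : sgraph) (R : zmodType) ks k (f : {ffun G -> R}) :
  k \in ks -> qsub k (qprod (rem k ks) f) = qprod ks f.
Proof.
elim: ks => //= j ks IH; rewrite inE; have [-> //|_ /= kks] := eqVneq k j.
by rewrite qsubC IH.
Qed.

Lemma qsub_eq0 (G : sgraph) (R : zmodType) k (f : {ffun G -> R}) :
  qsub k f = 0 -> qop f = f *+ k.
Proof. by move=> /eqP; rewrite subr_eq0 => /eqP. Qed.

Lemma qprod_eigen (G : sgraph) ks k (f : {ffun G -> int}) :
  qsub k f = 0 -> qprod ks f = f *~ \prod_(j <- ks) (k%:Z - j%:Z).
Proof.
move=> /qsub_eq0 fk; elim: ks => [|j ks IH] /=; first by rewrite big_nil.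
rewrite IH big_cons /qsub raddfMz /= fk; apply/ffunP => u.
rewrite !ffunE !ffunMzE !ffunMnE ffunMzE !pmulrn -!mulrzA -mulrzBr.
by rewrite [_ * j%:Z]mulrC -mulrBl.
Qed.

(** * Inner product and moments of integer vectors *)

Definition dot (G : sgraph) (f g : {ffun G -> int}) : int := \sum_u f u * g u.

Lemma dot_is_zmod_morphism (G : sgraph) (f : {ffun G -> int}) :
  zmod_morphism (dot f).
Proof.
move=> g h; rewrite /dot -sumrB; apply: eq_bigr => u _.
by rewrite !ffunE mulrBr.
Qed.

HB.instance Definition _ (G : sgraph) (f : {ffun G -> int}) :=
  GRing.isZmodMorphism.Build {ffun G -> int} int (dot f)
    (@dot_is_zmod_morphism G f).

Lemma dotC (G : sgraph) (f g : {ffun G -> int}) : dot f g = dot g f.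
Proof. by apply: eq_bigr => u _; rewrite mulrC. Qed.

Lemma dot_ge0 (G : sgraph) (f : {ffun G -> int}) : 0 <= dot f f.
Proof. by apply: sumr_ge0 => u _; rewrite -expr2 sqr_ge0. Qed.

Lemma dot_eq0 (G : sgraph) (f : {ffun G -> int}) : dot f f = 0 -> f = 0.
Proof.
move=> /eqP; rewrite psumr_eq0 => [/allP f0|u _]; last by rewrite -expr2 sqr_ge0.
apply/ffunP => u; rewrite ffunE; apply/eqP.
by have := f0 u (mem_index_enum _); rewrite mulf_eq0 orbb.
Qed.

Lemma dot_qop (G : sgraph) (f g : {ffun G -> int}) :
  dot (qop f) g = dot f (qop g).
Proof.
rewrite /dot (eq_bigr (fun u => f u * g u *+ deg u + \sum_(v | adj u v) f v * g u)).
  rewrite big_split /= sum_adj_exchange -big_split /=; apply: eq_bigr => u _.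
  by rewrite ffunE mulrDr mulr_sumr mulrnAr.
by move=> u _; rewrite ffunE mulrDl mulr_suml mulrnAl.
Qed.

Lemma dot_qsub (G : sgraph) k (f g : {ffun G -> int}) :
  dot (qsub k f) g = dot f (qsub k g).
Proof.
by rewrite /qsub dotC !raddfB !raddfMn /= dotC dot_qop [dot g f]dotC.
Qed.

Lemma dot_qprod (G : sgraph) ks (f g : {ffun G -> int}) :
  dot (qprod ks f) g = dot f (qprod ks g).
Proof. by elim: ks f g => //= k ks IH f g; rewrite dot_qsub IH qprod_qsub. Qed.

(** The monic polynomial with roots [j1], ..., [j5], expanded with [m k] in place of t^k. *)
Definition quintic (j1 j2 j3 j4 j5 : nat) (m : nat -> int) : int :=
  let: (x1, x2, x3, x4, x5) := (j1%:Z, j2%:Z, j3%:Z, j4%:Z, j5%:Z) in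
  m 5%N - (x1 + x2 + x3 + x4 + x5) * m 4%N
  + (x1 * x2 + x1 * x3 + x1 * x4 + x1 * x5 + x2 * x3 + x2 * x4 + x2 * x5
     + x3 * x4 + x3 * x5 + x4 * x5) * m 3%N
  - (x1 * x2 * x3 + x1 * x2 * x4 + x1 * x2 * x5 + x1 * x3 * x4 + x1 * x3 * x5
     + x1 * x4 * x5 + x2 * x3 * x4 + x2 * x3 * x5 + x2 * x4 * x5
     + x3 * x4 * x5) * m 2%N
  + (x1 * x2 * x3 * x4 + x1 * x2 * x3 * x5 + x1 * x2 * x4 * x5
     + x1 * x3 * x4 * x5 + x2 * x3 * x4 * x5) * m 1%N
  - x1 * x2 * x3 * x4 * x5 * m 0%N.

(** Stated for any additive functional, to cover both the pairing with [f] and the value at a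
    vertex. *)
Lemma qprod5E (G : sgraph) (phi : {additive {ffun G -> int} -> int})
    (j1 j2 j3 j4 j5 : nat) (f : {ffun G -> int}) :
  phi (qprod [:: j1; j2; j3; j4; j5] f) =
  quintic j1 j2 j3 j4 j5 (fun k => phi (iter k (@qop G int) f)).
Proof.
have qopMn n (g : {ffun G -> int}) : qop (g *+ n) = qop g *+ n.
  by rewrite raddfMn.
have phiMn n g : phi (g *+ n) = phi g * n%:Z by rewrite raddfMn /= -mulr_natr natz.
by rewrite /quintic /= /qsub !(raddfB, qopMn, phiMn) /=; ring.
Qed.

Arguments qprod : simpl never.

(** This is f^T Q^k f; at the indicator of u it is the diagonal entry (Q^k)_uu. *)
Definition moment (G : sgraph) (f : {ffun G -> int}) k :=
  dot f (iter k (@qop G int) f).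

Lemma dot_qprod5E (G : sgraph) (j1 j2 j3 j4 j5 : nat) (f : {ffun G -> int}) :
  dot f (qprod [:: j1; j2; j3; j4; j5] f) = quintic j1 j2 j3 j4 j5 (moment f).
Proof. exact: (qprod5E (dot f)). Qed.

Definition indic (G : sgraph) (u : G) : {ffun G -> int} := [ffun v => (v == u)%:R].

Lemma dot_indic (G : sgraph) (u : G) (f : {ffun G -> int}) : dot (indic u) f = f u.
Proof.
rewrite /dot (bigD1 u) //= big1 => [|v /negPf vu]; rewrite !ffunE ?vu ?mul0r //.
by rewrite eqxx mul1r addr0.
Qed.

Definition orbit_at (G : sgraph) (f : {ffun G -> int}) (u : G) k :=
  iter k (@qop G int) f u.

Lemma qprod5_at (G : sgraph) (j1 j2 j3 j4 j5 : nat) (f : {ffun G -> int}) u :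
  qprod [:: j1; j2; j3; j4; j5] f u = quintic j1 j2 j3 j4 j5 (orbit_at f u).
Proof.
rewrite -dot_indic (qprod5E (dot (indic u))) /quintic /=.
by rewrite !(dot_indic u) /orbit_at /=.
Qed.

(** * Transfer to integer vectors *)

Definition intC (G : sgraph) (f : {ffun G -> int}) : {ffun G -> algC} :=
  [ffun u => (f u)%:~R].

Lemma intC_qsub (G : sgraph) k (f : {ffun G -> int}) :
  qsub k (intC f) = intC (qsub k f).
Proof.
apply/ffunP => u; rewrite !ffunE !ffunMnE !ffunE rmorphB /= rmorphD /= !rmorphMn /=.
by rewrite rmorph_sum; congr (_ + _ - _); apply: eq_bigr => v _; rewrite ffunE.
Qed.

Lemma intC_qprod (G : sgraph) ks (f : {ffun G -> int}) :
  qprod ks (intC f) = intC (qprod ks f).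
Proof. by elim: ks => // k ks IH; rewrite !qprod_cons IH intC_qsub. Qed.

Lemma intC_inj (G : sgraph) : injective (@intC G).
Proof.
move=> f g /ffunP fg; apply/ffunP => u; apply: (@intr_inj algC).
by have := fg u; rewrite !ffunE.
Qed.

Lemma row_of_qprod (G : sgraph) ks (f : {ffun G -> algC}) :
  row_of (qprod ks f) =
  row_of f *m \big[mulmx/1%:M]_(k <- ks) (signless_laplacian G - k%:R%:M).
Proof.
elim: ks f => [|k ks IH] f; first by rewrite big_nil mulmx1.
rewrite qprod_cons -qprod_qsub IH big_cons mulmxA; congr (_ *m _).
rewrite mulmxBr row_of_mul mul_mx_scalar; apply/rowP => i.
by rewrite !mxE !ffunE !ffunMnE mulr_natl.
Qed.

Definition one_to_six := [:: 1; 2; 3; 4; 5; 6]%N.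

Section Spectrum.

Variable G : sgraph.
Hypotheses (G_connected : connected_graph G) (G_nonbipartite : ~ bipartite G).
Hypotheses (G_Q_integral : Q_integral G) (G_radius : is_Q_spectral_radius G 6%:R).

Lemma signless_normal : signless_laplacian G \is normalmx.
Proof.
apply: symmetric_normalmx; last first.
  apply/mxOverP => i j; rewrite !mxE; apply: realD; first exact: realn.
  by case: eqP => _; rewrite ?mulr1n ?mulr0n ?realn ?real0.
apply/is_hermitianmxP; rewrite expr0 scale1r map_mx_id //.
apply/matrixP => i j; rewrite !mxE adj_sym eq_sym; congr (_ + _).
by case: eqP => [->|].
Qed.

(** The eigenvalues are integers, positive and at most 6, and Q is diagonalizable. Together with
    [qprod5_neq0] this is all that later arguments use of the spectrum. *)
Lemma qprod_spectrum_eq0 (f : {ffun G -> int}) : qprod one_to_six f = 0.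
Proof.
apply: intC_inj; rewrite -intC_qprod; apply: row_of_inj.
rewrite row_of_qprod.
rewrite -(big_map (fun k : nat => k%:R) xpredT (fun c : algC => _ - c%:M)).
rewrite normalmx_prod_sub_eq0 ?signless_normal //.
  by rewrite mulmx0; apply/rowP => i; rewrite !mxE !ffunE.
move=> a eig_a; have ia := G_Q_integral eig_a.
have a_gt0 : 0 < a.
  apply: (nonbipartite_eigenvalue_gt0 G_connected G_nonbipartite _ eig_a).
  by rewrite Rreal_int.
have a_le6 : a <= 6%:R by case: G_radius => _; apply.
have /natrP [n aE] : a \is a Num.nat by rewrite natrEint ia ltW.
move: a_gt0 a_le6; rewrite aE ltr0n ler_nat => n_gt0 n_le6.
apply: (map_f (fun k : nat => k%:R : algC)).
by case: n n_gt0 n_le6 {aE} => [|[|[|[|[|[|[|n]]]]]]].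
Qed.

(** If the product vanished on all indicators it would be the zero matrix, but it multiplies an
    eigenvector for 6 by 120. *)
Lemma qprod5_neq0 : exists f : {ffun G -> int}, qprod [:: 1; 2; 3; 4; 5]%N f != 0.
Proof.
have [/existsP [u qu]|/existsPn Q0] :=
    boolP [exists u : G, qprod [:: 1; 2; 3; 4; 5]%N (indic u) != 0].
  by exists (indic u).
set Pi := \big[mulmx/1%:M]_(k <- [:: 1; 2; 3; 4; 5]%N)
  (signless_laplacian G - k%:R%:M).
have Pi0 : Pi = 0.
  apply/row_matrixP => i; rewrite row0 rowE.
  have -> : delta_mx 0 i = row_of (intC (indic (enum_val i))).
    apply/rowP => j; rewrite !mxE !ffunE (inj_eq enum_val_inj) eqxx andTb.
    by case: eqP.
  rewrite -row_of_qprod intC_qprod; have := Q0 (enum_val i).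
  rewrite negbK => /eqP ->.
  by apply/rowP => j; rewrite !mxE !ffunE.
case: G_radius => /eigenvalueP [w wQ w0] _; case/eqP: w0.
have wE ks : w *m \big[mulmx/1%:M]_(k <- ks) (signless_laplacian G - k%:R%:M) =
    (\prod_(k <- ks) (6%:R - k%:R)) *: w.
  elim: ks => [|k ks IH]; first by rewrite !big_nil scale1r mulmx1.
  rewrite !big_cons mulmxA mulmxBr wQ mul_mx_scalar -scalerBl -scalemxAl IH.
  by rewrite scalerA.
have := wE [:: 1; 2; 3; 4; 5]%N; rewrite -/Pi Pi0 mulmx0 => /esym/eqP.
rewrite scaler_eq0 => /orP [|/eqP //]; rewrite prodf_seq_eq0 => /hasP [k].
by rewrite !inE andTb subr_eq0 eqr_nat; do 4?case/orP; move=> /eqP ->.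
Qed.

End Spectrum.

(** * Spectral projectors and moments *)

Section Projectors.

Variable G : sgraph.
Hypothesis spectrum : forall f : {ffun G -> int}, qprod one_to_six f = 0.

(** The product of the Q - j with j != k is self-adjoint and maps into the eigenspace of k, so it is
    a multiple of the orthogonal projector onto that space. *)
Lemma dot_qprod_projector k (f : {ffun G -> int}) : k \in one_to_six ->
  let F := qprod (rem k one_to_six) f in
  dot f F * \prod_(j <- rem k one_to_six) (k%:Z - j%:Z) = dot F F.
Proof.
move=> k16 F; have Fk : qsub k F = 0 by rewrite qprod_rem.
by rewrite dot_qprod -/F (qprod_eigen _ Fk) raddfMz /= mulrzz.
Qed.

(* The sign of [prod_{j != k} (k - j)] alternates with k. *)
Lemma projector_signs (f : {ffun G -> int}) :
  let m := moment f in
  [/\ m 5%N - 20 * m 4%N + 155 * m 3%N - 580 * m 2%N + 1044 * m 1%N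
      - 720 * m 0%N <= 0,
      0 <= m 5%N - 19 * m 4%N + 137 * m 3%N - 461 * m 2%N + 702 * m 1%N
      - 360 * m 0%N,
      m 5%N - 18 * m 4%N + 121 * m 3%N - 372 * m 2%N + 508 * m 1%N
      - 240 * m 0%N <= 0,
      0 <= m 5%N - 17 * m 4%N + 107 * m 3%N - 307 * m 2%N + 396 * m 1%N
      - 180 * m 0%N
    & m 5%N - 16 * m 4%N + 95 * m 3%N - 260 * m 2%N + 324 * m 1%N
      - 144 * m 0%N <= 0].
Proof.
move=> m.
have S k : k \in one_to_six ->
    0 <= dot f (qprod (rem k one_to_six) f)
         * \prod_(j <- rem k one_to_six) (k%:Z - j%:Z).
  by move=> k16; rewrite dot_qprod_projector // dot_ge0.
split; [move: (S 1%N isT)|move: (S 2%N isT)|move: (S 3%N isT)|move: (S 4%N isT)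
       |move: (S 5%N isT)]; rewrite /= !big_cons big_nil dot_qprod5E /quintic /= -/m;
move: (m 5%N) (m 4%N) (m 3%N) (m 2%N) (m 1%N) (m 0%N) => m5 m4 m3 m2 m1 m0; lia.
Qed.

(** 6 m_0 - m_1 is the sum of the (6 - k) w_k, where w_k >= 0 is the squared norm of the component
    of [f] in the eigenspace of k. *)
Lemma rayleigh_quotient_le6 (f : {ffun G -> int}) :
  moment f 1%N <= 6 * moment f 0%N.
Proof.
have [] := projector_signs f; move: (moment f) => m *; lia.
Qed.

(** Equality forces w_k = 0 for k <= 5, so the projections of [f] onto these eigenspaces vanish. *)
Lemma rayleigh_quotient_eq6 (f : {ffun G -> int}) :
  moment f 1%N = 6 * moment f 0%N -> qsub 6 f = 0.
Proof.
move=> f6; have [P1 P2 P3 P4 P5] := projector_signs f.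
have F0 k : k \in [:: 1; 2; 3; 4; 5]%N -> qprod (rem k one_to_six) f = 0.
  move=> k15; apply: dot_eq0; rewrite -dot_qprod_projector; last first.
    by move: k15; rewrite !inE; do 4?[case/orP]; move=> /eqP ->.
  apply/eqP; rewrite mulf_eq0; apply/orP; left; apply/eqP.
  move: f6 P1 P2 P3 P4 P5; move: k15; rewrite !inE.
  do 4?[case/orP]; move=> /eqP -> /=; rewrite dot_qprod5E /quintic /=;
     move: (moment f) => m *; lia.
(* By Lagrange interpolation at 1, ..., 6 the polynomial t - 6, which vanishes at 6, is a
   combination of the five quintics. *)
apply/ffunP => u; rewrite [RHS]ffunE.
have E k : k \in [:: 1; 2; 3; 4; 5]%N -> qprod (rem k one_to_six) f u = 0.
  by move=> /F0 ->; rewrite ffunE.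
have -> : qsub 6 f u = orbit_at f u 1 - 6 * orbit_at f u 0.
  by rewrite qsubE pmulrn mulrzz mulrC.
have := E 1%N isT; rewrite qprod5_at /quintic /= => {P1} E1.
have := E 2%N isT; rewrite qprod5_at /quintic /= => {P2} E2.
have := E 3%N isT; rewrite qprod5_at /quintic /= => {P3} E3.
have := E 4%N isT; rewrite qprod5_at /quintic /= => {P4} E4.
have := E 5%N isT; rewrite qprod5_at /quintic /= => {P5} E5.
by move: (orbit_at f u) E1 E2 E3 E4 E5 => m *; lia.
Qed.

(* W is 120 times the weight of the eigenvalue 6, each [(t - a)(t - b)(t - c)]
   has constant sign on {1, ..., 5}, and the factors are its 120 / value at 6. *)
Lemma moment_inequalities (f : {ffun G -> int}) :
  let W := dot f (qprod [:: 1; 2; 3; 4; 5]%N f) in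
  let m := moment f in
  let cubic (a b c : int) := m 3%N - (a + b + c) * m 2%N
    + (a * b + a * c + b * c) * m 1%N - a * b * c * m 0%N in
  [/\ W <= 2 * cubic 1 2 3, W <= 4 * cubic 1 3 4 & W <= 12 * cubic 1 4 5] /\
  [/\ 6 * cubic 1 2 5 <= W, 10 * cubic 2 3 5 <= W & 20 * cubic 3 4 5 <= W].
Proof.
have [] := projector_signs f; rewrite dot_qprod5E /quintic /=.
by move: (moment f) => m *; do 2!split; lia.
Qed.

End Projectors.

(** * The integral Perron vector *)

Section Perron.

Variable G : sgraph.
Hypothesis G_connected : connected_graph G.
Hypothesis spectrum : forall f : {ffun G -> int}, qprod one_to_six f = 0.
Hypothesis qprod5_nonzero :
  exists f : {ffun G -> int}, qprod [:: 1; 2; 3; 4; 5]%N f != 0.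

Definition absf (f : {ffun G -> int}) : {ffun G -> int} := [ffun u => `|f u|].

(** Absolute values keep the norm and do not lower the quadratic form, so the Rayleigh quotient
    stays at its maximum 6. *)
Lemma qsub6_absf (f : {ffun G -> int}) : qsub 6 f = 0 -> qsub 6 (absf f) = 0.
Proof.
move=> f6; apply: (rayleigh_quotient_eq6 spectrum); apply: le_anti.
rewrite (rayleigh_quotient_le6 spectrum) /=.
have -> : moment (absf f) 0 = dot f f.
  rewrite /moment /dot /=; apply: eq_bigr => u _.
  by rewrite !ffunE -normrM -expr2 ger0_norm ?sqr_ge0.
have -> : 6 * dot f f = dot f (qop f).
  by rewrite (qsub_eq0 f6) raddfMn /= mulr_natl.
apply: ler_sum => u _; apply: le_trans (ler_norm _) _.
rewrite normrM !ffunE ler_wpM2l //; apply: le_trans (ler_normD _ _) _.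
rewrite normrMn lerD2l; apply: le_trans (ler_norm_sum _ _ _) _.
by apply: ler_sum => v _; rewrite ffunE.
Qed.

(** At a zero the nonnegative values of the neighbours sum to 0, so zeros spread over the connected
    graph. *)
Lemma nonneg_eigen6_eq0 (f : {ffun G -> int}) u0 :
  qsub 6 f = 0 -> (forall u, 0 <= f u) -> f u0 = 0 -> f = 0.
Proof.
move=> f6 f_ge0 fu0.
have step u v : adj u v -> f u = 0 -> f v = 0.
  move=> uv fu; have := congr1 (fun g : {ffun G -> int} => g u) (qsub_eq0 f6).
  rewrite /qop ffunE ffunMnE fu !mul0rn add0r => /eqP.
  rewrite psumr_eq0 => [/allP /(_ v (mem_index_enum _))|w _]; last exact: f_ge0.
  by rewrite uv => /eqP.
apply/ffunP => v; rewrite [RHS]ffunE; case: G_connected => _ conG.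
have /connectP [p up ->] := conG u0 v.
elim/last_ind: p up => //= p w IH.
by rewrite rcons_path last_rcons => /andP [/IH fp /step]; apply.
Qed.

(** |f| - f is a nonnegative eigenvector that vanishes at [u0]. *)
Lemma eigen6_ge0 (f : {ffun G -> int}) u0 :
  qsub 6 f = 0 -> 0 <= f u0 -> forall u, 0 <= f u.
Proof.
move=> f6 fu0 u; have g0 : absf f - f = 0.
  apply: (nonneg_eigen6_eq0 (u0 := u0)) => [|v|].
  - rewrite /qsub mulrnBl raddfB /= (qsub_eq0 f6) (qsub_eq0 (qsub6_absf f6)).
    by rewrite subrr.
  - by rewrite !ffunE subr_ge0 ler_norm.
  - by rewrite !ffunE ger0_norm ?subrr.
by move/ffunP: g0 => /(_ u); rewrite !ffunE => /eqP; rewrite subr_eq0 => /eqP <-.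
Qed.

Lemma eigen6_eq0 (f : {ffun G -> int}) u0 : qsub 6 f = 0 -> f u0 = 0 -> f = 0.
Proof.
move=> f6 fu0; apply: (nonneg_eigen6_eq0 (u0 := u0)) => //.
by apply: (@eigen6_ge0 _ u0); rewrite ?fu0.
Qed.

Lemma eigen6_gt0 (f : {ffun G -> int}) u0 :
  qsub 6 f = 0 -> 0 < f u0 -> forall u, 0 < f u.
Proof.
move=> f6 fu0 u; rewrite lt_def (eigen6_ge0 f6 (ltW fu0)) andbT.
by apply: contraTneq fu0 => /(eigen6_eq0 f6) ->; rewrite ffunE.
Qed.

Lemma eigen6_exists u0 : exists2 y : {ffun G -> int}, qsub 6 y = 0 & 0 < y u0.
Proof.
have [f0 F0] := qprod5_nonzero; pose y := qprod [:: 1; 2; 3; 4; 5]%N f0.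
have y6 : qsub 6 y = 0.
  by rewrite -[RHS](spectrum f0) -(@qprod_rem _ _ one_to_six 6).
exists (absf y); first exact: qsub6_absf.
rewrite ffunE normr_gt0; apply: contra F0 => /eqP yu0.
by rewrite -/y (eigen6_eq0 y6 yu0).
Qed.

(** Simplicity of the eigenvalue 6, free of division: the difference of the two multiples vanishes
    at [u0], hence everywhere. *)
Lemma eigen6_proportional (f g : {ffun G -> int}) u0 u :
  qsub 6 f = 0 -> qsub 6 g = 0 -> f u0 * g u = g u0 * f u.
Proof.
move=> f6 g6; have h6 : qsub 6 (g *~ f u0 - f *~ g u0) = 0.
  by rewrite raddfB !raddfMz /= f6 g6 oppr0 !mul0rz addr0.
have hu0 : (g *~ f u0 - f *~ g u0) u0 = 0.
  by rewrite !ffunE !ffunMzE !mulrzz mulrC subrr.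
have /ffunP /(_ u) := eigen6_eq0 h6 hu0.
rewrite !ffunE !ffunMzE !mulrzz => /eqP; rewrite subr_eq0 => /eqP fg.
by rewrite mulrC fg mulrC.
Qed.

Lemma eigen6_scale_eq0 (f : {ffun G -> int}) (c : int) :
  c != 0 -> qsub 6 (f *~ c) = 0 -> qsub 6 f = 0.
Proof.
rewrite raddfMz => c0 /ffunP fc; apply/ffunP => u.
have z0 : (0 : {ffun G -> int}) u = 0 by rewrite ffunE.
have := fc u; rewrite ffunMzE mulrzz z0 => /eqP.
by rewrite mulf_eq0 (negPf c0) orbF => /eqP.
Qed.

(** Eigenvectors are determined by their value at [u0], so the integral ones form a lattice of rank
    one, generated by the one with least positive value there. *)
Lemma eigen6_generator : exists x : {ffun G -> int},
  [/\ qsub 6 x = 0, forall u, 0 < x u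
    & forall f, qsub 6 f = 0 -> exists q : int, f = x *~ q].
Proof.
have [u0 _] : exists u : G, true.
  by case: G_connected => /card_gt0P [u _] _; exists u.
have [y y6 yu0] := eigen6_exists u0.
(* For the least such n, [(n / y u0) y] generates the integral multiples of y. *)
pose P n := (0 < n)%N && [forall u, y u0 %| n%:Z * y u]%Z.
have exP : exists n, P n.
  exists `|y u0|%N; apply/andP; split; first by lia.
  by apply/forallP => u; rewrite gtz0_abs ?dvdz_mulr.
case: (ex_minnP exP) => n /andP [n_gt0 /forallP yn] nmin.
pose x : {ffun G -> int} := [ffun u => (n%:Z * y u %/ y u0)%Z].
have xE u : y u0 * x u = n%:Z * y u by rewrite ffunE mulrC divzK.
have x6 : qsub 6 x = 0.
  apply: (@eigen6_scale_eq0 _ (y u0)); first by rewrite gt_eqF.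
  have -> : x *~ y u0 = y *~ n%:Z.
    by apply/ffunP => u; rewrite !ffunMzE !mulrzz mulrC xE mulrC.
  by rewrite raddfMz /= y6 mul0rz.
have xu0 : x u0 = n%:Z by rewrite ffunE mulzK // gt_eqF.
exists x; split => // [|f f6].
  by apply: (eigen6_gt0 x6 (u0 := u0)); rewrite xu0.
(* Division with remainder: [g] takes at [u0] the remainder modulo [n]; a nonzero one would be a
   smaller number satisfying [P]. *)
exists (f u0 %/ n)%Z; apply/eqP; rewrite -subr_eq0; apply/eqP.
set g := f - _; have g6 : qsub 6 g = 0.
  by rewrite raddfB raddfMz /= f6 x6 mul0rz subrr.
have gu0 : g u0 = (f u0 %% n)%Z.
  rewrite /g !ffunE ffunMzE mulrzz xu0; apply/eqP.
  by rewrite subr_eq addrC [n%:Z * _]mulrC -divz_eq.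
apply: (eigen6_eq0 g6 (u0 := u0)); rewrite gu0.
have r_ge0 : 0 <= (f u0 %% n)%Z by rewrite modz_ge0; lia.
have r_ltn : (f u0 %% n)%Z < n by rewrite ltz_pmod.
have [//|r0] := eqVneq (f u0 %% n)%Z 0.
have := nmin `|(f u0 %% n)%Z|%N; rewrite leqNgt => /implyP; rewrite implybN.
suff -> : P `|(f u0 %% n)%Z|%N by lia.
apply/andP; split; first by lia.
apply/forallP => u; rewrite gez0_abs // -gu0.
by rewrite (eigen6_proportional u0 u g6 y6) dvdz_mulr.
Qed.

(** Each column of the product is a multiple c_u x of the generator. Symmetry makes [c] itself an
    eigenvector, so c = a x and the matrix is a x x^T. *)
Lemma perron_integral : exists (alpha : nat) (x : G -> nat),
  [/\ forall u, (0 < x u)%N,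
      forall u, (x u * deg u + \sum_(v | adj u v) x v = 6 * x u)%N,
      (alpha * \sum_u x u ^ 2 = 120)%N
    & forall u v, qprod [:: 1; 2; 3; 4; 5]%N (indic u) v = (alpha * x u * x v)%N].
Proof.
have [x [x6 x_gt0 xgen]] := eigen6_generator.
pose F := qprod [:: 1; 2; 3; 4; 5]%N : {ffun G -> int} -> {ffun G -> int}.
have F6 f : qsub 6 (F f) = 0.
  by rewrite -[RHS](spectrum f) -(@qprod_rem _ _ one_to_six 6).
have [u0 _] : exists u : G, true.
  by case: G_connected => /card_gt0P [u _] _; exists u.
have Fsym u v : F (indic u) v = F (indic v) u.
  have := dot_qprod [:: 1; 2; 3; 4; 5]%N (indic u) (indic v).
  by rewrite dotC (dot_indic v) (dot_indic u).
pose c : {ffun G -> int} := [ffun u => F (indic u) u0 %/ x u0]%Z.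
have cE u : F (indic u) = x *~ c u.
  have [q qE] := xgen _ (F6 (indic u)); rewrite qE; congr (_ *~ _).
  by rewrite ffunE qE ffunMzE mulrzz mulrC mulzK // gt_eqF.
have c6 : qsub 6 c = 0.
  apply: (@eigen6_scale_eq0 _ (x u0)); first by rewrite gt_eqF.
  have -> : c *~ x u0 = x *~ c u0; last by rewrite raddfMz /= x6 mul0rz.
  apply/ffunP => u; rewrite !ffunMzE; have := Fsym u u0.
  by rewrite !cE !ffunMzE !mulrzz mulrC.
have [a aE] := xgen _ c6.
have FE u v : F (indic u) v = a * x u * x v.
  by rewrite cE aE !ffunMzE !mulrzz mulrC [a * _]mulrC.
(* The product sends [x] to 120 x, and also to a |x|^2 x. *)
have aS : a * \sum_u x u ^+ 2 = 120.
  have : F x u0 = 120 * x u0.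
    rewrite /F (qprod_eigen _ x6) ffunMzE mulrzz mulrC.
    by rewrite !big_cons big_nil.
  have := dot_qprod [:: 1; 2; 3; 4; 5]%N (indic u0) x.
  rewrite (dot_indic u0) -/(F _) -/(F _).
  have -> : dot (F (indic u0)) x = a * (\sum_u x u ^+ 2) * x u0.
    rewrite /dot mulr_sumr mulr_suml; apply: eq_bigr => u _.
    by rewrite FE; move: (x u) (x u0) => s t; ring.
  by move=> <- /mulIf; apply; rewrite gt_eqF.
have a_gt0 : 0 < a.
  have : 0 < a * \sum_u x u ^+ 2 by rewrite aS.
  rewrite pmulr_lgt0 // (bigD1 u0) //= ltr_wpDr ?exprn_gt0 //.
  by apply: sumr_ge0 => u _; rewrite sqr_ge0.
exists `|a|%N, (fun u => `|x u|%N); have xN u : `|x u|%N = x u :> int.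
  by rewrite gtz0_abs.
have aN : `|a|%N = a :> int by rewrite gtz0_abs.
split.
- by move=> u; rewrite absz_gt0 gt_eqF.
- move=> u; have /ffunP /(_ u) := qsub_eq0 x6; rewrite ffunE ffunMnE => xu.
  apply/eqP; rewrite -eqz_nat; apply/eqP; rewrite PoszD !PoszM xN.
  rewrite (big_morph Posz PoszD (erefl _)) (eq_bigr x) => [|v _]; last exact: xN.
  by rewrite !pmulrn !mulrzz in xu; rewrite xu mulrC.
- apply/eqP; rewrite -eqz_nat; apply/eqP; rewrite PoszM aN.
  rewrite (big_morph Posz PoszD (erefl _)) -[RHS]aS; congr (_ * _).
  by apply: eq_bigr => u _; rewrite -xN -rmorphXn.
- by move=> u v; rewrite FE !PoszM aN !xN.
Qed.

End Perron.

(** * Closed walks at a vertex *)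

Definition codeg (G : sgraph) (u v : G) : nat := #|[set w | adj u w & adj v w]|.

(** The part of (Q^3)_uu that [deg u] alone does not determine. *)
Definition walk_excess (G : sgraph) (u : G) : nat :=
  (\sum_(v | adj u v) deg v + \sum_(v | adj u v) codeg u v)%N.

Lemma qop_indic (G : sgraph) (u v : G) :
  qop (indic u) v = (v == u)%:R * (deg u)%:Z + (adj u v)%:R.
Proof.
rewrite /qop ffunE; congr (_ + _).
  rewrite ffunE; case: eqP => [->|_]; rewrite ?mul0rn ?mul0r //.
  by rewrite mul1r pmulrn mulrzz mul1r.
rewrite adj_sym; case uv: (adj v u).
  rewrite (bigD1 u) //= ffunE eqxx big1 ?addr0 // => w /andP [_ /negPf wu].
  by rewrite ffunE wu.
rewrite big1 // => w vw; rewrite ffunE; case: eqP => // wu.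
by rewrite -wu vw in uv.
Qed.

Lemma qop2_indic (G : sgraph) (u v : G) : adj u v ->
  qop (qop (indic u)) v = (deg v + deg u + codeg u v)%N.
Proof.
move=> uv; rewrite {1}/qop ffunE qop_indic uv; have -> : v == u = false.
  by apply: contraTF uv => /eqP ->; rewrite adj_irrefl.
rewrite mul0r add0r (eq_bigr (fun w => (w == u)%:R * (deg u)%:Z + (adj u w)%:R)).
  rewrite big_split /= !PoszD -addrA; congr (_ + (_ + _)).
  - by rewrite pmulrn mulrzz mul1r.
  - rewrite (bigD1 u) 1?adj_sym //= eqxx mul1r big1 ?addr0 //.
    by move=> w /andP [_ /negPf ->]; rewrite mul0r.
  - rewrite /codeg -sum1_card (big_morph Posz PoszD (erefl _)) big_mkcond /=.
    rewrite [RHS]big_mkcond; apply: eq_bigr => w _; rewrite inE.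
    by case: (adj v w); case: (adj u w).
by move=> w _; rewrite qop_indic.
Qed.

Lemma qop2_indic_diag (G : sgraph) (u : G) :
  qop (qop (indic u)) u = (deg u ^ 2 + deg u)%N.
Proof.
rewrite {1}/qop ffunE qop_indic eqxx adj_irrefl mul1r addr0.
rewrite (eq_bigr (fun=> 1)).
  by rewrite sum_adj_const pmulrn mulrzz natz; lia.
move=> w uw; rewrite qop_indic uw.
have -> : w == u = false; last by rewrite mul0r add0r.
by apply: contraTF uw => /eqP ->; rewrite adj_irrefl.
Qed.

Lemma moment_indic (G : sgraph) (u : G) : let m := moment (indic u) in
  [/\ m 0%N = 1, m 1%N = deg u, m 2%N = (deg u ^ 2 + deg u)%N
    & m 3%N = (deg u ^ 3 + 2 * deg u ^ 2 + walk_excess u)%N].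
Proof.
move=> m; rewrite /m /moment !(dot_indic u) /=; split.
- by rewrite ffunE eqxx.
- by rewrite qop_indic eqxx adj_irrefl mul1r addr0.
- exact: qop2_indic_diag.
(* (Q^3)_uu is deg(u) (Q^2)_uu plus the sum of (Q^2)_uv over the neighbours v. *)
- rewrite {1}/qop ffunE qop2_indic_diag pmulrn mulrzz.
  rewrite (eq_bigr (fun v => (deg v + deg u + codeg u v)%N%:Z)); last first.
    by move=> v uv; rewrite qop2_indic.
  rewrite -(big_morph Posz PoszD (erefl _)) !big_split /= sum_nat_const.
  have -> : #|adj u| = deg u by apply: eq_card => v; rewrite inE.
  by rewrite /walk_excess; lia.
Qed.

(** * Search over partial labelled graphs *)

Local Close Scope ring_scope.

Section Admissible.

Local Open Scope Z_scope.

(* [moment_inequalities] at an indicator, with the moments of [moment_indic]: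
   w stands for alpha x_u^2, d for the degree and s for [walk_excess u]. *)
Definition cubic_moment (a b c d s : Z) : Z :=
  d * d * (d + 2) + s - (a + b + c) * (d * (d + 1))
  + (a * b + a * c + b * c) * d - a * b * c.

Definition admissible_Z (w d s : Z) : bool :=
  let E a b c := cubic_moment a b c d s in
  [&& Z.leb w (2 * E 1 2 3), Z.leb w (4 * E 1 3 4), Z.leb w (12 * E 1 4 5),
      Z.leb (6 * E 1 2 5) w, Z.leb (10 * E 2 3 5) w & Z.leb (20 * E 3 4 5) w].

End Admissible.

Definition admissible (w d s : nat) : bool :=
  admissible_Z (Z.of_nat w) (Z.of_nat d) (Z.of_nat s).

(* Degree and Perron entry of a vertex. *)
Definition label := (nat * nat)%type.

(** The finite ranges lose no vertex of G, as [label_in_table] shows. Labels without an admissible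
    excess are dropped. *)
Definition label_table (alpha : nat) : seq (label * seq nat) :=
  [seq t <- [seq ((d, x), [seq s <- iota 0 30 | admissible (alpha * x * x) d s])
            | d <- [:: 2; 3; 4], x <- iota 1 10] | t.2 != [::]]%N.

Definition lookup (T : seq (label * seq nat)) (l : label) : seq nat :=
  (nth (l, [::]) T (index l (unzip1 T))).2.

(* A state (L, nb) describes distinct vertices 0, ..., size L - 1 of the graph: L
   gives their labels, and nb gives the complete neighbourhoods of the first
   size nb of them, all of which lie inside the state. *)
Section Search.

Variables (alpha budget : nat) (T : seq (label * seq nat)).

Implicit Types (L : seq label) (nb : seq (seq nat)).

Definition lab L j : label := nth (0, 0)%N L j.

Definition nbrs nb i : seq nat := nth [::] nb i.

Definition known_nbrs nb i : seq nat :=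
  if (i < size nb)%N then nbrs nb i
  else [seq j <- iota 0 (size nb) | i \in nbrs nb j].

(** Adjacency of two vertices is undecided while neither neighbourhood is complete. [surely_adj] and
    [maybe_adj] then answer no and yes, which bounds codegrees from both sides. *)
Definition surely_adj nb i j : bool :=
  if (i < size nb)%N then j \in nbrs nb i
  else (j < size nb)%N && (i \in nbrs nb j).

Definition maybe_adj nb i j : bool :=
  if (i < size nb)%N then j \in nbrs nb i
  else if (j < size nb)%N then i \in nbrs nb j else i != j.

Definition weight L (N : seq nat) : nat := sumn [seq (lab L j).2 | j <- N].

(** The eigenvalue equation makes the entries at the neighbours sum to (6 - d) x; each neighbour
    still missing adds at least 1. *)
Definition sum_check L nb i : bool :=
  let N := known_nbrs nb i in
  let: (d, x) := lab L i in
  let: target := ((6 - d) * x)%N in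
  let: t := weight L N in
  [&& size N <= d, t + (d - size N) <= target & (size N == d) ==> (t == target)]%N.

Definition walk_check L nb i : bool :=
  let N := nbrs nb i in
  let D := sumn [seq (lab L j).1 | j <- N] in
  let lo := (D + sumn [seq count (surely_adj nb j) N | j <- N])%N in
  let hi := (D + sumn [seq count (maybe_adj nb j) N | j <- N])%N in
  has (fun s => lo <= s <= hi)%N (lookup T (lab L i)).

(* Only the conditions affected by the last completed neighbourhood. *)
Definition check L nb : bool :=
  let k := (size nb).-1 in
  let N := nbrs nb k in
  [&& sumn [seq l.2 * l.2 | l <- L] <= budget,
      all (fun j => (lab L k).1 + (lab L j).1 <= 7) N,
      all (sum_check L nb) (k :: N)
    & all (fun i => (i < size nb) ==> walk_check L nb i) (k :: N)]%N.

(* Choices of neighbours of total number at most o and total weight at most r, with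
   what remains of o and r to be filled by new vertices. *)
Fixpoint pick_old L (s : seq nat) (o r : nat) : seq (seq nat * (nat * nat)) :=
  if s is j :: s' then
    pick_old L s' o r ++
    (if (0 < o) && ((lab L j).2 <= r)
     then [seq (j :: p.1, p.2) | p <- pick_old L s' o.-1 (r - (lab L j).2)]
     else [::])
  else [:: ([::], (o, r))].

(** New vertices with equal labels are interchangeable, so only the number [c] of each label is
    chosen. *)
Fixpoint pick_new (ls : seq label) (o r : nat) : seq (seq label) :=
  if ls is l :: ls' then
    flatten [seq [seq nseq c l ++ W | W <- pick_new ls' (o - c) (r - c * l.2)]
            | c <- [seq c <- iota 0 o.+1 | c * l.2 <= r]]
  else if (o == 0) && (r == 0) then [:: [::]] else [::].

Definition extensions L nb : seq (seq label * seq nat) :=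
  let k := size nb in
  let K := known_nbrs nb k in
  let: (d, x) := lab L k in
  flatten
    [seq [seq (W, K ++ p.1 ++ iota (size L) (size W))
         | W <- pick_new (unzip1 T) p.2.1 p.2.2]
    | p <- pick_old L (iota k.+1 (size L - k.+1)) (d - size K)
             ((6 - d) * x - weight L K)].

(** Q - k on value tables, for states in which every neighbourhood is complete. *)
Definition table_qsub L nb (k : nat) (f : seq Z) : seq Z :=
  let f_ j := nth Z0 f j in
  [seq Z.add (Z.mul (Z.sub (Z.of_nat (lab L i).1) (Z.of_nat k)) (f_ i))
             (foldr Z.add Z0 [seq f_ j | j <- nbrs nb i])
  | i <- iota 0 (size L)].

Definition table_qprod L nb : seq Z :=
  foldr (table_qsub L nb)
    [seq (if i == 0 then Z.of_nat 1 else Z0) | i <- iota 0 (size L)]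
    [:: 1; 2; 3; 4; 5]%N.

(** Compares only the row of vertex 0 in the rank-one identity. *)
Definition rank_one_check L nb : bool :=
  all (fun i => Z.eqb (nth Z0 (table_qprod L nb) i)
                  (Z.of_nat (alpha * (lab L 0).2 * (lab L i).2)))
    (iota 0 (size L)).

(** The target with its vertices numbered in the order v3, v1, v2, v4, v5, v6. *)
Definition target_nbrs : seq (seq nat) :=
  [:: [:: 1; 2; 3; 4]; [:: 0; 2]; [:: 0; 1]; [:: 0; 4; 5]; [:: 0; 3; 5]; [:: 3; 4]].

(* [if] rather than [==>], which [vm_compute] would evaluate on both sides. *)
Fixpoint search (fuel : nat) L nb : bool :=
  if fuel is fuel'.+1 then
    if size nb == size L
    then if rank_one_check L nb then nb == target_nbrs else true
    else all (fun e => let: (W, N) := e in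
                if check (L ++ W) (rcons nb N)
                then search fuel' (L ++ W) (rcons nb N) else true)
           (extensions L nb)
  else false.

End Search.

(** The budget is |x|^2 = 120 / alpha. Exhausted fuel yields [false], so the value [true] also
    certifies that 50 steps suffice. *)
Definition search_all : bool :=
  all (fun alpha => let T := label_table alpha in
         all (fun x => if (4, x) \in unzip1 T
                then search alpha (120 %/ alpha) T 50 [:: (4, x)] [::] else true)
           (iota 1 10))
    [seq a <- iota 1 120 | (a %| 120)].

Lemma search_allT : search_all.
Proof. by vm_compute. Qed.

Local Open Scope ring_scope.

(** * Bounds on degrees, Perron entries and walk excesses *)

Section Labels.

Variables (G : sgraph) (alpha : nat) (x : G -> nat).
Hypothesis spectrum : forall f : {ffun G -> int}, qprod one_to_six f = 0.
Hypothesis x_gt0 : forall u, (0 < x u)%N.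
Hypothesis normalized : (alpha * \sum_u x u ^ 2 = 120)%N.
Hypothesis rank_one :
  forall u v, qprod [:: 1; 2; 3; 4; 5]%N (indic u) v = (alpha * x u * x v)%N.
Hypothesis edge_deg : forall u v : G, adj u v -> (deg u + deg v <= 7)%N.
Hypothesis has_edge : exists u v : G, adj u v.

Lemma alpha_gt0 : (0 < alpha)%N.
Proof. by case: alpha normalized. Qed.

(** An edge provides a second vertex, whose positive share of the total 120 is left out. *)
Lemma weight_lt120 (u : G) : (alpha * x u * x u < 120)%N.
Proof.
have [v vu] : exists v : G, v != u.
  have [a [b ab]] := has_edge; have [au|] := eqVneq a u; last by exists a.
  by exists b; apply: contraTneq ab => ->; rewrite au adj_irrefl.
rewrite -normalized (bigD1 u) //= (bigD1 v) //= mulnDr -mulnA.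
rewrite -[(x u * x u)%N]/(x u ^ 2)%N.
by rewrite -[ltnLHS]addn0 ltn_add2l muln_gt0 alpha_gt0 addn_gt0 expn_gt0 x_gt0.
Qed.

Lemma deg_le6 (u : G) : (deg u <= 6)%N.
Proof.
have [->//|] := posnP (deg u); rewrite card_gt0 => /set0Pn [v]; rewrite inE => uv.
have := edge_deg uv; suff : (0 < deg v)%N by lia.
by rewrite card_gt0; apply/set0Pn; exists u; rewrite inE adj_sym.
Qed.

(** For each fixed degree up to 6 the inequalities are linear in w and s; with 0 < w < 120 the
    degrees 0, 1, 5 and 6 are infeasible. *)
Lemma admissible_label (u : G) :
  (2 <= deg u <= 4)%N && admissible (alpha * x u * x u) (deg u) (walk_excess u).
Proof.
have /= := moment_inequalities spectrum (indic u).
have [-> -> -> ->] := moment_indic u; rewrite (dot_indic u) rank_one.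
have := weight_lt120 u; have := deg_le6 u.
have : (0 < alpha * x u * x u)%N by rewrite !muln_gt0 alpha_gt0 x_gt0.
move: (alpha * x u * x u)%N (deg u) (walk_excess u) => w d s w_gt0.
rewrite /admissible /admissible_Z /cubic_moment.
case: d => [|[|[|[|[|[|[|//]]]]]]] _ w_lt [[I1 I2 I3] [I4 I5 I6]]; lia.
Qed.

Lemma label_in_table (u : G) :
  (deg u, x u) \in unzip1 (label_table alpha) /\
  walk_excess u \in lookup (label_table alpha) (deg u, x u).
Proof.
have /andP [d24 adm] := admissible_label u.
pose good (l : label) := [seq s <- iota 0 30 | admissible (alpha * l.2 * l.2) l.1 s].
have s_good : walk_excess u \in good (deg u, x u).
  rewrite mem_filter adm mem_iota /=; have := weight_lt120 u; move: adm d24.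
  rewrite /admissible /admissible_Z /cubic_moment.
  move: (alpha * x u * x u)%N (deg u) (walk_excess u) => w d s.
  by case: d => [|[|[|[|[|//]]]]] //; lia.
(* As alpha >= 1, the square of the entry is below 120. *)
have x10 : (x u <= 10)%N.
  have := weight_lt120 u; have := alpha_gt0; rewrite -mulnA; nia.
have l_in : ((deg u, x u), good (deg u, x u)) \in label_table alpha.
  rewrite mem_filter; apply/andP; split; first by apply: contraTneq s_good => /= ->.
  apply/allpairsP; exists (deg u, x u); split; rewrite // ?mem_iota /=.
    by case: (deg u) d24 => [|[|[|[|[|//]]]]].
  by rewrite x_gt0; lia.
have l_in1 : (deg u, x u) \in unzip1 (label_table alpha).
  exact: (map_f fst l_in).
split=> //; rewrite /lookup.
set i := index _ _; set t := nth _ _ _.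
have i_lt : (i < size (label_table alpha))%N by rewrite -(size_map fst) index_mem.
have t1 : t.1 = (deg u, x u) by rewrite /t -(nth_map _ (0, 0)%N fst) // nth_index.
(* Every entry of the table carries the list determined by its label, so it does not matter which
   one the lookup hits. *)
have : t \in label_table alpha by exact: mem_nth.
rewrite mem_filter => /andP [_ /allpairsP [[d y] [_ _ tE]]].
have t2 : t.2 = good t.1 by rewrite tE.
by rewrite t2 t1.
Qed.

End Labels.

(** * Soundness of the search *)

Lemma leq_count_in (I : eqType) (a b : pred I) (s : seq I) :
  {in s, subpred a b} -> (count a s <= count b s)%N.
Proof.
elim: s => //= i s IH ab; rewrite leq_add ?IH // => [|j js]; last first.
  by apply: ab; rewrite inE js orbT.
by have := ab i (mem_head _ _); case: (a i) => // ->.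
Qed.

Lemma leq_sumn_in (I : eqType) (F1 F2 : I -> nat) (s : seq I) :
  {in s, forall j, F1 j <= F2 j}%N ->
  (sumn [seq F1 j | j <- s] <= sumn [seq F2 j | j <- s])%N.
Proof.
elim: s => //= j s IH le12; rewrite leq_add ?le12 ?mem_head ?IH // => l ls.
by rewrite le12 // inE ls orbT.
Qed.

Section Soundness.

Variables (G : sgraph) (x : G -> nat) (u0 : G).
Variables (alpha budget : nat) (T : seq (label * seq nat)).

Hypothesis G_connected : forall u v : G, connect (@adj G) u v.
Hypothesis x_gt0 : forall u, (0 < x u)%N.
Hypothesis x_eigen :
  forall u, (x u * deg u + \sum_(v | adj u v) x v = 6 * x u)%N.
Hypothesis x_budget : (\sum_u x u ^ 2 <= budget)%N.
Hypothesis rank_one :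
  forall u v, qprod [:: 1; 2; 3; 4; 5]%N (indic u) v = (alpha * x u * x v)%N.
Hypothesis edge_deg : forall u v : G, adj u v -> (deg u + deg v <= 7)%N.
Hypothesis label_in_T : forall u : G, (deg u, x u) \in unzip1 T.
Hypothesis excess_in_T : forall u : G, walk_excess u \in lookup T (deg u, x u).

Implicit Types (L : seq label) (nb : seq (seq nat)) (phi : seq G).

Definition label_of (u : G) : label := (deg u, x u).

Notation at_ phi := (nth u0 phi).

(** [phi] sends the numbers of a state to vertices of G. Soundness follows a realized state down one
    branch of the search. *)
Definition realizes phi L nb : Prop :=
  [/\ uniq phi, L = map label_of phi, (size nb <= size phi)%N
    & forall i, (i < size nb)%N ->
        all (fun j => j < size phi)%N (nbrs nb i) /\
        perm_eq [seq at_ phi j | j <- nbrs nb i] (enum (adj (at_ phi i)))].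

Lemma size_enum_adj (u : G) : size (enum (adj u)) = deg u.
Proof. by rewrite -cardE; apply: eq_card => v; rewrite inE. Qed.

Lemma sum_enum_adj (F : G -> nat) (u : G) :
  (\sum_(v | adj u v) F v)%N = sumn [seq F v | v <- enum (adj u)].
Proof. by rewrite sumnE big_map big_enum. Qed.

Lemma codegE (u v : G) : codeg u v = count (adj v) (enum (adj u)).
Proof.
rewrite /codeg -size_filter cardE; apply/perm_size/uniq_perm.
- exact: enum_uniq.
- exact/filter_uniq/enum_uniq.
- by move=> w; rewrite mem_enum inE [RHS]mem_filter mem_enum andbC.
Qed.

Lemma sum_x (u : G) : sumn [seq x v | v <- enum (adj u)] = ((6 - deg u) * x u)%N.
Proof.
have := x_eigen u; rewrite sum_enum_adj mulnBl [(x u * _)%N]mulnC => <-.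
by rewrite addKn.
Qed.

Section State.

Variables (phi : seq G) (L : seq label) (nb : seq (seq nat)).
Hypothesis phiP : realizes phi L nb.

Let n := size phi.

Lemma size_L : size L = n.
Proof. by case: phiP => _ -> _ _; rewrite size_map. Qed.

Lemma labE j : (j < n)%N -> lab L j = label_of (at_ phi j).
Proof. by case: phiP => _ -> _ _ jn; rewrite /lab (nth_map u0). Qed.

Lemma mem_nbrs i j : (i < size nb)%N -> (j < n)%N ->
  (j \in nbrs nb i) = adj (at_ phi i) (at_ phi j).
Proof.
case: phiP => phi_uniq _ nb_phi nbP i_nb jn; have [/allP N_lt N_perm] := nbP i i_nb.
have := perm_mem N_perm (at_ phi j); rewrite mem_enum => memE.
rewrite -[RHS]/(at_ phi j \in adj (at_ phi i)) -memE.
apply/idP/mapP => [jN|[l lN /eqP]]; first by exists j.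
by rewrite nth_uniq // ?N_lt // => /eqP ->.
Qed.

Lemma surely_adjP i j : (i < n)%N -> (j < n)%N ->
  surely_adj nb i j -> adj (at_ phi i) (at_ phi j).
Proof.
move=> i_n j_n; rewrite /surely_adj; case: ifP => [i_nb|_]; first by rewrite mem_nbrs.
by case/andP => j_nb; rewrite mem_nbrs // adj_sym.
Qed.

Lemma maybe_adjP i j : (i < n)%N -> (j < n)%N ->
  adj (at_ phi i) (at_ phi j) -> maybe_adj nb i j.
Proof.
move=> i_n j_n ij; rewrite /maybe_adj; case: ifP => [i_nb|_].
  by rewrite mem_nbrs.
case: ifP => [j_nb|_]; first by rewrite mem_nbrs // adj_sym.
by apply: contraTneq ij => ->; rewrite adj_irrefl.
Qed.

Lemma known_nbrsE i : (size nb <= i < n)%N ->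
  known_nbrs nb i = [seq j <- iota 0 (size nb) | adj (at_ phi i) (at_ phi j)].
Proof.
case: phiP => _ _ nb_n _ /andP [nb_i i_n]; rewrite /known_nbrs ltnNge nb_i /=.
apply: eq_in_filter => j; rewrite mem_iota add0n /= => j_nb.
by rewrite mem_nbrs // adj_sym.
Qed.

Lemma known_nbrs_lt i j : (i < n)%N -> j \in known_nbrs nb i -> (j < n)%N.
Proof.
move=> i_n; have [i_nb|nb_i] := ltnP i (size nb).
  by rewrite /known_nbrs i_nb; case: phiP => _ _ _ /(_ i i_nb) [/allP h _] /h.
rewrite known_nbrsE ?nb_i // mem_filter mem_iota => /andP [_ /andP [_ j_nb]].
by case: phiP => _ _ nb_n _; apply: leq_trans j_nb _.
Qed.

Lemma known_nbrs_uniq i : (i < n)%N -> uniq [seq at_ phi j | j <- known_nbrs nb i].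
Proof.
move=> i_n; case: (phiP) => phi_uniq _ nb_n nbP.
have [i_nb|nb_i] := ltnP i (size nb).
  rewrite /known_nbrs i_nb; have [_ /perm_uniq ->] := nbP i i_nb; exact: enum_uniq.
rewrite map_inj_in_uniq; first by rewrite known_nbrsE ?nb_i // filter_uniq ?iota_uniq.
move=> j l /(known_nbrs_lt i_n) j_n /(known_nbrs_lt i_n) l_n /eqP.
by rewrite nth_uniq // => /eqP.
Qed.

Lemma known_nbrs_adj i j : (i < n)%N -> j \in known_nbrs nb i ->
  adj (at_ phi i) (at_ phi j).
Proof.
move=> i_n jK; have j_n := known_nbrs_lt i_n jK; move: jK.
have [i_nb|nb_i] := ltnP i (size nb); first by rewrite /known_nbrs i_nb mem_nbrs.
by rewrite known_nbrsE ?nb_i // mem_filter => /andP [].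
Qed.

Lemma weightE N : all (fun j => j < n)%N N ->
  weight L N = sumn [seq x v | v <- [seq at_ phi j | j <- N]].
Proof.
move=> /allP N_n; rewrite /weight -map_comp; congr sumn; apply/eq_in_map => j jN.
by rewrite labE ?N_n.
Qed.

(** The true neighbourhood splits into the known part [M] and a rest [R], whose entries are
    positive. *)
Lemma sum_checkT i : (i < n)%N -> sum_check L nb i.
Proof.
move=> i_n; rewrite /sum_check labE //=; set N := known_nbrs nb i; set u := at_ phi i.
have N_n : all (fun j => j < n)%N N by apply/allP => j /(known_nbrs_lt i_n).
pose M := [seq at_ phi j | j <- N].
pose R := [seq v <- enum (adj u) | v \notin M].
have split_adj : perm_eq (enum (adj u)) (M ++ R).
  apply: uniq_perm; first exact: enum_uniq.
    rewrite cat_uniq known_nbrs_uniq // filter_uniq ?enum_uniq // andbT.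
    by apply/hasPn => v; rewrite mem_filter => /andP [].
  move=> v; rewrite mem_cat [X in _ || X]mem_filter; case vM : (v \in M) => //=.
  case/mapP: vM => j jN ->; rewrite mem_enum; exact: known_nbrs_adj.
have degE : deg u = (size N + size R)%N.
  by rewrite -size_enum_adj (perm_size split_adj) size_cat size_map.
have sumE : (weight L N + sumn [seq x v | v <- R] = (6 - deg u) * x u)%N.
  rewrite weightE // -sum_x (perm_sumn (perm_map x split_adj)).
  by rewrite map_cat sumn_cat.
have R_le : (size R <= sumn [seq x v | v <- R])%N.
  by elim: (R) => //= v R' IH; rewrite -add1n leq_add ?x_gt0.
rewrite -sumE degE leq_addr addKn leq_add2l R_le /=.
apply/implyP; rewrite -[X in X == _]addn0 eqn_add2l eq_sym size_eq0 => /eqP ->.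
by rewrite addn0.
Qed.

Lemma walk_checkT i : (i < size nb)%N -> walk_check T L nb i.
Proof.
case: (phiP) => _ _ nb_n nbP i_nb; have [/allP N_n N_perm] := nbP i i_nb.
have i_n : (i < n)%N by apply: leq_trans nb_n.
apply/hasP; exists (walk_excess (at_ phi i)); first by rewrite labE // excess_in_T.
have sumE F : (\sum_(v | adj (at_ phi i) v) F v)%N =
    sumn [seq F (at_ phi j) | j <- nbrs nb i].
  by rewrite sum_enum_adj -(perm_sumn (perm_map F N_perm)) -map_comp.
rewrite /walk_excess !sumE.
have -> : [seq deg (at_ phi j) | j <- nbrs nb i] = [seq (lab L j).1 | j <- nbrs nb i].
  by apply/eq_in_map => j /N_n j_n; rewrite labE.
rewrite !leq_add2l.
have codegN j : codeg (at_ phi i) (at_ phi j) =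
    count (fun l => adj (at_ phi j) (at_ phi l)) (nbrs nb i).
  by rewrite codegE -(permP N_perm) count_map.
apply/andP; split; apply: leq_sumn_in => j jN; rewrite codegN;
  apply: leq_count_in => l lN; [apply: surely_adjP | apply: maybe_adjP];
  exact: N_n.
Qed.

Lemma checkT : (0 < size nb)%N -> check budget T L nb.
Proof.
case: (phiP) => phi_uniq LE nb_n nbP nb_gt0; rewrite /check.
set k := (size nb).-1; have k_nb : (k < size nb)%N by rewrite /k prednK.
have k_n : (k < n)%N by apply: leq_trans nb_n.
have [/allP N_n _] := nbP k k_nb.
apply/and4P; split.
(* [phi] has no repetition, so its squares sum to at most |x|^2. *)
- rewrite LE -map_comp sumnE big_map; apply: leq_trans x_budget.
  rewrite big_uniq //= [leqRHS](bigID (mem phi)) /=; exact: leq_addr.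
- apply/allP => j jN; rewrite (labE k_n) (labE (N_n _ jN)) /=.
  by apply: edge_deg; rewrite -(mem_nbrs k_nb (N_n _ jN)).
- apply/andP; split; first exact: sum_checkT.
  by apply/allP => i iN; exact/sum_checkT/N_n.
- apply/andP; split; first by apply/implyP; exact: walk_checkT.
  by apply/allP => i _; apply/implyP; exact: walk_checkT.
Qed.

End State.

Lemma pick_oldP L (a : pred nat) (s : seq nat) (o r : nat) :
  let e := filter a s in
  (size e <= o)%N -> (weight L e <= r)%N ->
  (e, (o - size e, r - weight L e))%N \in pick_old L s o r.
Proof.
elim: s o r => [|j s IH] o r /=; first by rewrite /weight /= !subn0 mem_head.
rewrite mem_cat; case: (a j); last by move=> eo er; rewrite IH.
rewrite /weight /= -/(weight L _) => eo er.
have -> : (0 < o)%N && ((lab L j).2 <= r)%N by lia.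
set e := filter a s in eo er *.
apply/orP; right; apply/mapP.
exists (e, (o.-1 - size e, r - (lab L j).2 - weight L e))%N.
  by apply: IH; rewrite -/e; lia.
by congr (_, (_, _)); lia.
Qed.

(** Choices come grouped by label, so [V] has to be reordered; the induction splits off the vertices
    with the first label. *)
Lemma pick_newP (ls : seq label) (V : seq G) :
  {in V, forall v, label_of v \in ls} ->
  exists2 V', perm_eq V' V &
    map label_of V' \in pick_new ls (size V) (sumn [seq x v | v <- V]).
Proof.
elim: ls V => [|l ls IH] V V_ls.
  by case: V V_ls => [_|v V /(_ v (mem_head _ _)) //]; exists [::].
pose is_l v := label_of v == l; pose R := [seq v <- V | ~~ is_l v].
have [v|R' R'_perm R'_in] := IH R.
  rewrite mem_filter => /andP [v_l /V_ls]; rewrite inE => /predU1P [vl|//].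
  by rewrite /is_l vl eqxx in v_l.
have splitV : perm_eq ([seq v <- V | is_l v] ++ R') V.
  by rewrite perm_sym -(perm_filterC is_l V) perm_cat2l perm_sym.
exists ([seq v <- V | is_l v] ++ R') => //.
pose c := count is_l V.
have lE : map label_of [seq v <- V | is_l v] = nseq c l.
  have /all_pred1P -> : all (pred1 l) (map label_of [seq v <- V | is_l v]).
    apply/allP => m /mapP [v]; rewrite mem_filter => /andP [vl _] ->; exact: vl.
  by rewrite size_map size_filter.
have sizeE : size V = (c + size R)%N.
  by rewrite /c -size_filter -size_cat (perm_size (permEl (perm_filterC is_l V))).
have sumE : sumn [seq x v | v <- V] = (c * l.2 + sumn [seq x v | v <- R])%N.
  rewrite -(perm_sumn (perm_map x (permEl (perm_filterC is_l V)))) map_cat sumn_cat.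
  congr (_ + _)%N; have -> : map x [seq v <- V | is_l v] = map snd (nseq c l).
    by rewrite -lE -map_comp.
  by rewrite map_nseq sumn_nseq mulnC.
rewrite map_cat lE; apply/flattenP.
exists [seq nseq c l ++ W | W <- pick_new ls (size R) (sumn [seq x v | v <- R])].
  apply/mapP; exists c; last by rewrite sizeE sumE !addKn.
  by rewrite mem_filter mem_iota sizeE sumE leq_addr /= add0n ltnS leq_addr.
by apply/mapP; exists (map label_of R').
Qed.

(** The neighbourhood of the next vertex in G consists of completed vertices [K], later known
    vertices [e] and unseen vertices [V]. Appending the latter, suitably ordered, to [phi] realizes
    one of the generated extensions. *)
Lemma extensionP phi L nb : realizes phi L nb -> (size nb < size phi)%N ->
  exists phi' W N,
    (W, N) \in extensions T L nb /\ realizes phi' (L ++ W) (rcons nb N).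
Proof.
move=> phiP nb_n; case: (phiP) => phi_uniq LE _ nbP.
set k := size nb in nb_n *; set n := size phi in nb_n *; pose u := at_ phi k.
pose V := [seq v <- enum (adj u) | v \notin phi].
have [V' V'_perm V'_in] : exists2 V', perm_eq V' V &
    map label_of V' \in pick_new (unzip1 T) (size V) (sumn [seq x v | v <- V]).
  by apply: pick_newP => v _; exact: label_in_T.
have memV v : (v \in V') = (v \notin phi) && adj u v.
  by rewrite (perm_mem V'_perm) [LHS]mem_filter mem_enum.
pose phi' := phi ++ V'; pose W := map label_of V'.
pose K := known_nbrs nb k.
pose e := [seq j <- iota k.+1 (n - k.+1) | adj u (at_ phi j)].
pose N := K ++ e ++ iota n (size V').
have phi'_uniq : uniq phi'.
  rewrite cat_uniq phi_uniq (perm_uniq V'_perm) filter_uniq ?enum_uniq // andbT.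
  by apply/hasPn => v; rewrite memV => /andP [].
have size_phi' : size phi' = (n + size V')%N by rewrite size_cat.
have at_phi' j : (j < n)%N -> at_ phi' j = at_ phi j by move=> jn; rewrite nth_cat jn.
have KE : K = [seq j <- iota 0 k | adj u (at_ phi j)].
  by rewrite /K (known_nbrsE phiP) // /k leqnn.
have iotaE : iota 0 n = iota 0 k ++ k :: iota k.+1 (n - k.+1).
  have {1}-> : n = (k + (n - k.+1).+1)%N by lia.
  by rewrite iotaD.
(* The three pieces list all neighbour positions in increasing order; position [k] drops out for
   lack of loops. *)
have NE : N = [seq j <- iota 0 (size phi') | adj u (at_ phi' j)].
  rewrite size_phi' iotaD filter_cat iotaE filter_cat /= add0n /N KE -catA.
  rewrite at_phi' // adj_irrefl; congr (_ ++ (_ ++ _)).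
  - by apply: eq_in_filter => j; rewrite mem_iota => j_k; rewrite at_phi' //; lia.
  - by apply: eq_in_filter => j; rewrite mem_iota => j_k; rewrite at_phi' //; lia.
  - apply/esym/all_filterP/allP => j; rewrite mem_iota => /andP [n_j j_lt].
    have : at_ phi' j \in V' by rewrite nth_cat ltnNge n_j /= mem_nth // ltn_subLR.
    by rewrite memV => /andP [].
have N_perm : perm_eq [seq at_ phi' j | j <- N] (enum (adj u)).
  have -> : [seq at_ phi' j | j <- N] = [seq v <- phi' | adj u v].
    rewrite NE -[in RHS](mkseq_nth u0 phi') /mkseq filter_map.
    by congr map; apply: eq_filter.
  apply: uniq_perm; [exact: filter_uniq|exact: enum_uniq|move=> v].
  rewrite [LHS]mem_filter mem_enum -[v \in adj u]/(adj u v).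
  case uv: (adj u v); rewrite // mem_cat memV uv andbT.
  by case: (v \in phi).
have e_lt : all (fun j => j < n)%N e.
  by apply/allP => j; rewrite mem_filter mem_iota => /andP [_]; lia.
have K_lt : all (fun j => j < n)%N K.
  by rewrite KE; apply/allP => j; rewrite mem_filter mem_iota => /andP [_]; lia.
have N_lt : all (fun j => j < size phi')%N N.
  by rewrite NE; apply/allP => j; rewrite mem_filter mem_iota => /andP [_].
exists phi', W, N; split; last first.
  split=> //; first by rewrite LE /phi' map_cat.
    by rewrite size_rcons size_phi' ltn_addr.
  move=> i; rewrite size_rcons ltnS leq_eqVlt => /predU1P [->|i_k].
    by rewrite /nbrs nth_rcons ltnn eqxx at_phi'.
  have [i_lt i_perm] := nbP i i_k; rewrite /nbrs nth_rcons i_k; split.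
    by apply: sub_all i_lt => j; rewrite size_phi'; apply: ltn_addr.
  rewrite at_phi'; last exact: ltn_trans nb_n.
  suff -> : [seq at_ phi' j | j <- nth [::] nb i] =
    [seq at_ phi j | j <- nbrs nb i] by [].
  by apply/eq_in_map => j /(allP i_lt); exact: at_phi'.
have sum_W : sumn [seq x v | v <- V'] = sumn [seq x v | v <- V].
  exact: perm_sumn (perm_map x V'_perm).
have sizeN : deg u = (size K + size e + size V)%N.
  rewrite -size_enum_adj -(perm_size N_perm) size_map !size_cat size_iota.
  by rewrite (perm_size V'_perm) addnA.
have sumN : ((6 - deg u) * x u =
    weight L K + weight L e + sumn [seq x v | v <- V])%N.
  rewrite -sum_x -(perm_sumn (perm_map x N_perm)) !map_cat !sumn_cat addnA.
  rewrite !(weightE phiP) // -sum_W; congr (_ + _ + _)%N.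
  - by congr (sumn (map x _)); apply/eq_in_map => j /(allP K_lt); exact: at_phi'.
  - by congr (sumn (map x _)); apply/eq_in_map => j /(allP e_lt); exact: at_phi'.
  - congr (sumn (map x _)); apply: (@eq_from_nth _ u0); rewrite size_map size_iota //.
    move=> i i_lt; rewrite (nth_map 0%N) ?size_iota // nth_iota //.
    by rewrite nth_cat ltnNge leq_addr /= addKn.
rewrite /extensions -/k -/K (labE phiP nb_n) (size_L phiP) /label_of -/u.
set new := fun p => _; apply/flattenP.
(* What the old neighbours leave of degree and weight is exactly what [V] supplies. *)
exists (new (e, (size V, sumn [seq x v | v <- V]))).
  apply/map_f.
  have := @pick_oldP L (fun j => adj u (at_ phi j)) (iota k.+1 (n - k.+1))
    (deg u - size K) ((6 - deg u) * x u - weight L K).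
  have -> : (size V = deg u - size K - size e)%N by lia.
  have -> : (sumn [seq x v | v <- V] =
      (6 - deg u) * x u - weight L K - weight L e)%N by lia.
  by apply; rewrite -/e; lia.
by apply/mapP; exists W; rewrite // /N size_map.
Qed.

Section Closed.

Variables (phi : seq G) (L : seq label) (nb : seq (seq nat)).
Hypothesis phiP : realizes phi L nb.
Hypothesis closed : size nb = size phi.
Hypothesis phi_gt0 : (0 < size phi)%N.

(** With all neighbourhoods complete, [phi] is closed under adjacency, hence exhausts the connected
    graph. *)
Lemma closed_full v : v \in phi.
Proof.
case: (phiP) => _ _ _ nbP.
have /connectP [p v0p ->] := G_connected (at_ phi 0) v.
elim/last_ind: p v0p => [|p w IH] /=; first by rewrite mem_nth.
rewrite rcons_path last_rcons => /andP [/IH last_phi adj_w].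
have i_nb : (index (last (at_ phi 0) p) phi < size nb)%N by rewrite closed index_mem.
have [/allP N_lt /perm_mem /(_ w)] := nbP _ i_nb.
rewrite mem_enum nth_index // -[RHS]/(adj _ w) adj_w => /mapP [j /N_lt j_lt ->].
exact: mem_nth.
Qed.

Definition tabulates (f : seq Z) (F : {ffun G -> int}) :=
  forall i, (i < size phi)%N -> nth Z0 f i = Z_of_int (F (at_ phi i)).

Lemma tabulates_qsub k f F :
  tabulates f F -> tabulates (table_qsub L nb k f) (qsub k F).
Proof.
case: (phiP) => _ _ _ nbP fF i i_n.
have [/allP N_lt N_perm] := nbP i (eq_ind_r (leq i.+1) i_n closed).
rewrite (nth_map 0%N) ?size_iota ?(size_L phiP) // nth_iota ?(size_L phiP) // add0n.
have sumE : foldr Z.add Z0 [seq nth Z0 f j | j <- nbrs nb i] =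
    Z_of_int (\sum_(v | adj (at_ phi i) v) F v).
  rewrite -big_enum /= -(perm_big _ N_perm) big_map /=.
  elim: (nbrs nb i) N_lt {N_perm} => [|j s IH] s_lt /=; first by rewrite big_nil.
  rewrite big_cons IH => [|l ls]; last by rewrite s_lt // inE ls orbT.
  by rewrite fF ?s_lt ?mem_head //; lia.
rewrite sumE qsubE ffunE (labE phiP i_n) fF //= !pmulrn !mulrzz.
move: (\sum_(v | _) _) (F _) => a b; lia.
Qed.

Lemma rank_one_checkT : rank_one_check alpha L nb.
Proof.
have tabF : tabulates (table_qprod L nb)
    (qprod [:: 1; 2; 3; 4; 5]%N (indic (at_ phi 0))).
  rewrite /table_qprod; do 5!apply: tabulates_qsub.
  move=> i i_n.
  rewrite (nth_map 0%N) ?size_iota ?(size_L phiP) // nth_iota ?(size_L phiP) //.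
  case: phiP => phi_uniq _ _ _; rewrite ffunE nth_uniq // add0n.
  by case: eqP.
apply/allP => i; rewrite mem_iota (size_L phiP) => i_n; rewrite tabF // rank_one.
by rewrite !(labE phiP) //=; apply/Z.eqb_eq; lia.
Qed.

(* The search finds v3 first, and then v1, v2, v4, v5, v6. *)
Definition target_position (i : nat) : nat := nth 0%N [:: 2; 0; 1; 3; 4; 5]%N i.

Lemma target_isomorphic : nb = target_nbrs -> isomorphic G target_graph.
Proof.
move=> nbE; have n6 : size phi = 6%N by rewrite -closed nbE.
pose f u : target_graph := (inord (target_position (index u phi)) : 'I_6).
have idx_lt u : (index u phi < 6)%N by rewrite -n6 index_mem closed_full.
have f_val u : f u = target_position (index u phi) :> nat.
  by rewrite inordK //; case: (index u phi) (idx_lt u) => [|[|[|[|[|[|]]]]]].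
have f_inj : injective f.
  move=> u v /(congr1 (fun i : 'I_6 => i : nat)); rewrite !f_val => uv.
  rewrite -(nth_index u0 (closed_full u)) -(nth_index u0 (closed_full v)).
  congr nth; move: uv (idx_lt u) (idx_lt v).
  by case: (index u phi) => [|[|[|[|[|[|]]]]]] //;
     case: (index v phi) => [|[|[|[|[|[|]]]]]].
exists f.
  (* An injection between sets of six elements is bijective. *)
  have cardG : #|G| = 6%N.
    rewrite -n6 cardE; apply/perm_size/uniq_perm; first exact: enum_uniq.
      by case: phiP.
    by move=> v; rewrite mem_enum closed_full.
  by apply: inj_card_bij => //; rewrite cardG [X in (X <= _)%N](card_ord 6).
move=> u v; rewrite -[in RHS](nth_index u0 (closed_full u)).
rewrite -[in RHS](nth_index u0 (closed_full v)) -(mem_nbrs phiP);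
  rewrite ?closed ?index_mem ?closed_full //.
rewrite /= /target_adj !f_val nbE; move: (idx_lt u) (idx_lt v).
by case: (index u phi) => [|[|[|[|[|[|]]]]]] //;
   case: (index v phi) => [|[|[|[|[|[|]]]]]].
Qed.

End Closed.

(** G itself selects an extension that passes every check. Once the state is closed, the rank-one
    identity holds, so the search can only have accepted it as the target. *)
Lemma searchP fuel phi L nb : realizes phi L nb -> (0 < size phi)%N ->
  search alpha budget T fuel L nb -> isomorphic G target_graph.
Proof.
elim: fuel phi L nb => // fuel IH phi L nb phiP phi_gt0 /=.
rewrite (size_L phiP); case: eqP => [closed|not_closed].
  by rewrite (rank_one_checkT phiP) // => /eqP; exact: target_isomorphic phiP _ _.
have nb_lt : (size nb < size phi)%N.
  by case: phiP => _ _ nb_le _; rewrite ltn_neqAle nb_le andbT; apply/eqP.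
have [phi' [W [N [WN_in phi'P]]]] := extensionP phiP nb_lt.
move=> /allP /(_ _ WN_in); rewrite (checkT phi'P) ?size_rcons //.
apply: (IH _ _ _ phi'P); apply: leq_ltn_trans (leq0n (size nb)) _.
by case: phi'P => _ _; rewrite size_rcons.
Qed.

End Soundness.

(* Otherwise unification would run the search. *)
Opaque search label_table.

Lemma search_allP (alpha x : nat) : (alpha %| 120)%N -> (0 < x <= 10)%N ->
  ((4, x) \in unzip1 (label_table alpha))%N ->
  search alpha (120 %/ alpha) (label_table alpha) 50 [:: (4, x)]%N [::].
Proof.
move=> a120 x_range x_in; have a_gt0 : (0 < alpha)%N by exact: dvdn_gt0 a120.
have a_in : alpha \in [seq a <- iota 1 120 | (a %| 120)%N].
  by rewrite mem_filter a120 mem_iota a_gt0 add1n ltnS dvdn_leq.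
have x_in10 : x \in iota 1 10 by rewrite mem_iota add1n ltnS.
have := search_allT; rewrite /search_all => all_a.
have all_x := allP all_a alpha a_in.
have := allP all_x x x_in10.
by rewrite x_in.
Qed.

(* Reduction of the theorem to the search *)
Local Close Scope ring_scope.

Theorem theorem1p1 (G : sgraph) (G_connected : connected_graph G)
    (G_Q_integral : Q_integral G)
    (G_radius : is_Q_spectral_radius G 6%:R%R)
    (G_edge_degree : max_edge_degree G = 5)
    (G_nonbipartite : ~ bipartite G) :
  isomorphic G target_graph.
Proof.
have spectrum := qprod_spectrum_eq0 G_connected G_nonbipartite G_Q_integral G_radius.
have [alpha [x [x_gt0 x_eigen x_norm rank_one]]] :=
  perron_integral G_connected spectrum (qprod5_neq0 G_radius).
have edge_deg (u v : G) : adj u v -> (deg u + deg v <= 7)%N.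
  move=> uv; have := @leq_bigmax_cond _ (fun p : G * G => adj p.1 p.2)
    (fun p => edge_degree p.1 p.2) (u, v) uv.
  by rewrite -/(max_edge_degree G) G_edge_degree /edge_degree /=; lia.
(* The maximum is attained at an edge, since without edges it would be 0. *)
have [u [v [uv deg7]]] : exists u v : G, adj u v /\ (deg u + deg v = 7)%N.
  have [|[u v] /= uv E] := @eq_bigmax_cond _ (fun p : G * G => adj p.1 p.2)
    (fun p => edge_degree p.1 p.2).
    apply: contraPT (G_edge_degree) => /=.
    rewrite -eqn0Ngt => /eqP /card0_eq no_edge.
    by rewrite /max_edge_degree big_pred0.
  exists u, v; split=> //; move: E; rewrite -/(max_edge_degree G) G_edge_degree.
  by rewrite /edge_degree; lia.
have has_edge : exists u v : G, adj u v by exists u, v.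
have lab_ok := label_in_table spectrum x_gt0 x_norm rank_one edge_deg has_edge.
have deg24 w := admissible_label spectrum x_gt0 x_norm rank_one edge_deg has_edge w.
(* Two degrees that are at most 4 and sum to 7 are 3 and 4. *)
have [w w4] : exists w : G, deg w = 4%N.
  have /andP [/andP [_ u4] _] := deg24 u; have /andP [/andP [_ v4] _] := deg24 v.
  have : (deg u = 4 \/ deg v = 4)%N by lia.
  by case; [exists u | exists v].
have a_gt0 : (0 < alpha)%N := alpha_gt0 x_norm.
(* The initial state is the single vertex [w], with no neighbourhood completed. *)
apply: (@searchP G x w alpha (120 %/ alpha) (label_table alpha) _ x_gt0 x_eigen
  _ rank_one edge_deg _ _ 50 [:: w] [:: (4, x w)] [::]%N).
- by case: G_connected.
- by rewrite -x_norm mulKn.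
- by move=> y; case: (lab_ok y).
- by move=> y; case: (lab_ok y).
- by split; rewrite //= /label_of w4.
- by [].
apply: search_allP.
- by rewrite -x_norm dvdn_mulr.
- rewrite x_gt0 /=; have := weight_lt120 x_gt0 x_norm has_edge w; nia.
- by rewrite -w4; case: (lab_ok w).
Qed.
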